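(* Let $N\ge 1$ be an integer and $\sigma\neq 0$ a real constant. Let $u$ be the function and $\overline p_i/y_i$ the optimal production rate defined in the context, with $r=|y|$. Then the optimal production rate is given by $$\frac{\overline p_i}{y_i}=\sigma^2\frac{u'(r)}{r\,u(r)}=\frac{4\sigma^2}{r^2}\sum_{j=0}^{\infty}c_j\left[\frac{r^4}{4\sigma^4}\right]^j,\qquad r\neq 0,$$ where $a_0=1$, $c_0=0$, and for $j=1,2,3,\dots$ $$a_j=\frac{1}{j!\,(N+2)(N+6)\cdots(N+4j-2)},\qquad b_j=\frac{j}{j!\,(N+2)(N+6)\cdots(N+4j-2)},$$ $$c_j=\frac{1}{a_0}\left[b_j-\sum_{i=1}^{j}c_{j-i}\,a_i\right].$$
   Context: The function $u$ is $$u(r)=1+\sum_{j=1}^{\infty}\frac{1}{j!\,(N+2)(N+6)\cdots(N+4j-2)}\left(\frac{r^2}{2\sigma^2}\right)^{2j},\qquad r\ge 0,$$ where $(N+2)(N+6)\cdots(N+4j-2)=\prod_{i=1}^{j}(N+4i-2)$. It is the radial solution of $\Delta u=\frac{1}{\sigma^4}|x|^2u$ with $u(0)=1$. Setting: inventories $y=(y_1,\dots,y_N)$ evolve as $dy_i=p_i\,dt+\sigma\,dw_i$ with $w$ an $N$-dimensional Brownian motion, and one minimizes $E\int_0^\tau(|p|^2+|y|^2)\,dt$, where $\tau$ is the first time $|y(t)|\ge R$. With $v(x)=2\sigma^2\ln u(|x|)$, the optimal feedback control is $\overline p_i(y)=\frac12\frac{\partial v}{\partial x_i}(y)$, $i=1,\dots,N$,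 for $y\in\mathbb{R}^N$, and the (optimal) production rate of good $i$ is the ratio $\overline p_i(y)/y_i$ (for $y_i\neq 0$). Here $|\cdot|$ is the Euclidean norm.
   Formalization: The series formula is proved for every r ≠ 0 at which the series converges, and the power series is shown to have a positive radius of convergence; for large r the series diverges (e.g. N=2, r^4/(4σ^4)=6), so the formula cannot hold for all r ≠ 0. *)

(* Defs.v *)
From Stdlib Require Import Reals.
From mathcomp Require Import ssreflect ssrfun ssrbool eqtype ssrnat seq fintype bigop.
From Coquelicot Require Import Coquelicot.

Set Implicit Arguments.
Unset Strict Implicit.
Unset Printing Implicit Defensive.

Local Open Scope R_scope.

Definition denom (N j : nat) : R :=
  INR (Factorial.fact j) *
  \big[Rmult/1]_(1 <= i < j.+1) (INR N + 4 * INR i - 2).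

(* At j = 0 the product is empty, so a_coef N 0 = 1. *)
Definition a_coef (N j : nat) : R := 1 / denom N j.

Definition b_coef (N j : nat) : R := INR j / denom N j.

(* The sum over j >= 1 is reindexed by j = k.+1. *)
Definition u (N : nat) (sigma r : R) : R :=
  1 + Series (fun k => a_coef N k.+1 *
                       (r ^ 2 / (2 * sigma ^ 2)) ^ (2 * k.+1)).

(* A point of R^N is a function 'I_N -> R. *)
Definition enorm (N : nat) (y : 'I_N -> R) : R :=
  sqrt (\big[Rplus/0]_(k < N) (y k ^ 2)).

Definition partial (N : nat) (f : ('I_N -> R) -> R) (i : 'I_N)
    (y : 'I_N -> R) : R :=
  Derive (fun t => f (fun k => if k == i then t else y k)) (y i).

Definition v (N : nat) (sigma : R) (x : 'I_N -> R) : R :=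
  2 * sigma ^ 2 * ln (u N sigma (enorm x)).

Definition pbar (N : nat) (sigma : R) (i : 'I_N) (y : 'I_N -> R) : R :=
  1 / 2 * partial (v sigma) i y.

(* Main.v *)
Require Import Defs.
From Stdlib Require Import Reals Lra.
From HB Require Import structures.
From mathcomp Require Import ssreflect ssrfun ssrbool eqtype ssrnat seq fintype bigop.
From Coquelicot Require Import Coquelicot.

Local Open Scope R_scope.

(** With [x = r ^ 4 / (4 sigma ^ 4)] and [A(x) = sum_j a_j x ^ j] one has
    [u(r) = A(x)], so [r u'(r) = 4 x A'(x) = 4 sum_j b_j x ^ j], and the
    recursion for [c] says that the Cauchy product of [a] and [c] is [b].
    Bounding [a_j] and [b_j] by [1] in the recursion gives [|c_j| <= 2 ^ j],
    hence a positive radius of convergence. *)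

(** These two instances let the generic [bigop] lemmas act on sums and products over [R]. *)
HB.instance Definition _ := Monoid.isComLaw.Build R 0 Rplus
  (fun x y z => esym (Rplus_assoc x y z)) Rplus_comm Rplus_0_l.

HB.instance Definition _ := Monoid.isComLaw.Build R 1 Rmult
  (fun x y z => esym (Rmult_assoc x y z)) Rmult_comm Rmult_1_l.

(** * Power series up to the boundary of the disk of convergence *)

Lemma big_nat_sum_f_R0 (f : nat -> R) (n : nat) :
  \big[Rplus/0]_(0 <= i < n.+1) f i = sum_f_R0 f n.
Proof.
elim: n => [|n IHn]; first by rewrite big_nat1.
by rewrite big_nat_recr //= IHn.
Qed.

(** Strictly outside the disk the terms do not tend to 0, so the series cannot converge there. *)
Lemma ex_pseries_le_CV_radius (a : nat -> R) (x : R) :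
  ex_pseries a x -> Rbar_le (Rabs x) (CV_radius a).
Proof.
move/ex_pseries_R=> exa; apply: Rbar_not_lt_le => ltx.
exact: (CV_disk_outside _ _ ltx) (ex_series_lim_0 _ exa).
Qed.

(** Convergence at [x] leaves two cases: [x] is inside the disk, where the sum is continuous, or [x]
    is the radius, where Abel's theorem applies. *)
Lemma PSeries_at_left (a : nat -> R) (x : R) :
  0 < x -> Rbar_lt 0 (CV_radius a) -> ex_pseries a x ->
  filterlim (PSeries a) (at_left x) (locally (PSeries a x)).
Proof.
move=> x_gt0 ra_gt0 exa.
have xE : Rabs x = x by apply: Rabs_pos_eq; lra.
have := @ex_pseries_le_CV_radius _ _ exa; rewrite xE.
case/Rbar_le_lt_or_eq_dec => [ltx|eqx].
  apply: filterlim_filter_le_1 (filter_le_within _) _.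
  apply/continuity_pt_filterlim/PSeries_continuity.
  by rewrite xE.
have := @Abel a ra_gt0; rewrite -eqx /=.
by apply.
Qed.

(* On the boundary of the disk of convergence of [c] the series of [c] may
   converge only conditionally; Abel's theorem then passes to the limit in the
   identity valid inside the disk. *)
Lemma PSeries_mult_boundary (a b c : nat -> R) (x : R) :
  (forall n, PS_mult a c n = b n) ->
  0 < x -> Rbar_lt x (CV_radius a) -> Rbar_lt x (CV_radius b) ->
  Rbar_lt 0 (CV_radius c) -> ex_pseries c x ->
  PSeries b x = PSeries a x * PSeries c x.
Proof.
move=> mulE x_gt0 ltxa ltxb rc_gt0 exc.
have xE : Rabs x = x by apply: Rabs_pos_eq; lra.
have exl (d : nat -> R) : Rbar_lt x (CV_radius d) ->
    filterlim (PSeries d) (at_left x) (locally (PSeries d x)).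
  move=> ltxd; apply: PSeries_at_left => //.
    exact: (Rbar_lt_trans _ x).
  by apply: CV_radius_inside; rewrite xE.
(* Both sides are limits of [PSeries b] from the left at [x]. *)
apply: (@filterlim_locally_unique _ _ _ (at_left x) _ (PSeries b)).
  exact: exl.
apply: (filterlim_ext_loc (fun t => PSeries a t * PSeries c t)).
  (* A neighbourhood of radius [x] keeps [t] positive, so [Rabs t = t < x] lies strictly inside both
     disks. *)
  exists (mkposreal _ x_gt0) => t /= xt ltt.
  have t_gt0 : 0 < t.
    by move: xt; rewrite /ball /= /AbsRing_ball /abs /minus /plus /opp /= => /Rabs_def2; lra.
  have tE : Rabs t = t by apply: Rabs_pos_eq; lra.
  rewrite -(PSeries_ext _ _ t mulE) PSeries_mult // tE.
    exact: (Rbar_lt_trans _ x).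
  apply: (Rbar_lt_le_trans _ x) => //.
  by rewrite -{1}xE; apply: ex_pseries_le_CV_radius.
apply: (filterlim_comp_2 (PSeries a) (PSeries c) Rmult (exl a ltxa)
         (PSeries_at_left c x x_gt0 rc_gt0 exc)).
exact: (@filterlim_mult R_AbsRing).
Qed.

(** * The coefficients [a] and [b] *)

Lemma denomS (N j : nat) :
  denom N j.+1 = denom N j * (INR j.+1 * (INR N + 4 * INR j.+1 - 2)).
Proof.
rewrite /denom big_nat_recr //.
have -> : Factorial.fact j.+1 = (j.+1 * Factorial.fact j)%coq_nat by [].
by rewrite mult_INR /= -/(INR j.+1); ring.
Qed.

Lemma denom_factor_ge (N j : nat) :
  INR j.+1 <= INR j.+1 * (INR N + 4 * INR j.+1 - 2).
Proof.
have := pos_INR N; have := pos_INR j; rewrite S_INR => j_ge0 N_ge0.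
by rewrite -{1}[INR j + 1]Rmult_1_r; apply: Rmult_le_compat_l; lra.
Qed.

Lemma denom0 (N : nat) : denom N 0 = 1.
Proof. by rewrite /denom big_geq //= Rmult_1_r. Qed.

Lemma denom_ge1 (N j : nat) : 1 <= denom N j.
Proof.
elim: j => [|j IHj]; first by rewrite denom0; lra.
rewrite denomS -[1]Rmult_1_r; apply: Rmult_le_compat; try lra.
apply: Rle_trans (denom_factor_ge N j).
by rewrite S_INR; have := pos_INR j; lra.
Qed.

Lemma denom_geINR (N j : nat) : INR j <= denom N j.
Proof.
case: j => [|j]; first by have := denom_ge1 N 0; rewrite /=; lra.
rewrite denomS -[INR j.+1]Rmult_1_l; apply: Rmult_le_compat.
- lra.
- exact: pos_INR.
- exact: denom_ge1.
- by rewrite Rmult_1_l; apply: denom_factor_ge.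
Qed.

Lemma a_coef0 (N : nat) : a_coef N 0 = 1.
Proof. by rewrite /a_coef denom0; field. Qed.

Lemma a_coef_bounds (N j : nat) : 0 < a_coef N j <= 1.
Proof.
have dj := denom_ge1 N j; rewrite /a_coef; split.
  by apply: Rdiv_lt_0_compat; lra.
by apply/Rle_div_l; lra.
Qed.

Lemma b_coef_bounds (N j : nat) : 0 <= b_coef N j <= 1.
Proof.
have dj := denom_ge1 N j; rewrite /b_coef; split.
  by apply: Rdiv_le_0_compat; [apply: pos_INR | lra].
by apply/Rle_div_l; [lra | rewrite Rmult_1_l; apply: denom_geINR].
Qed.

(** Since b_j = j a_j, the series of [b] is x A'(x): differentiate, then shift by one. *)
Lemma b_coefE (N j : nat) : b_coef N j = PS_incr_1 (PS_derive (a_coef N)) j.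
Proof.
rewrite /b_coef /PS_incr_1 /PS_derive /a_coef.
by case: j => [|j]; rewrite /Rdiv ?Rmult_0_l ?Rmult_1_l.
Qed.

(** Ratio test: a_(j+1) / a_j is the inverse of the new factor of [denom], hence at most 1 /
    (j+1). *)
Lemma CV_radius_a_coef (N : nat) : CV_radius (a_coef N) = p_infty.
Proof.
apply: CV_radius_infinite_DAlembert => [j|].
  by have := a_coef_bounds N j; lra.
apply: (is_lim_seq_le_le (fun=> 0) _ (fun j => / INR j.+1)).
- move=> j; split; first exact: Rabs_pos.
  have dj := denom_ge1 N j.
  have fj := denom_factor_ge N j.
  have j_gt0 : 0 < INR j.+1 by rewrite S_INR; have := pos_INR j; lra.
  have -> : a_coef N j.+1 / a_coef N j =
      / (INR j.+1 * (INR N + 4 * INR j.+1 - 2)).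
    by rewrite /a_coef denomS; field; repeat split; try lra; nra.
  rewrite Rabs_pos_eq; first exact: Rinv_le_contravar.
  by apply/Rlt_le/Rinv_0_lt_compat; lra.
- exact: is_lim_seq_const.
- apply: (is_lim_seq_inv _ p_infty) => //.
  by apply/(is_lim_seq_incr_1 INR)/is_lim_seq_INR.
Qed.

Lemma CV_radius_b_coef (N : nat) : CV_radius (b_coef N) = p_infty.
Proof.
by rewrite (CV_radius_ext _ _ (b_coefE N)) CV_radius_incr_1 CV_radius_derive
           CV_radius_a_coef.
Qed.

Lemma PSeries_b_coef (N : nat) (x : R) :
  PSeries (b_coef N) x = x * PSeries (PS_derive (a_coef N)) x.
Proof. by rewrite (PSeries_ext _ _ x (b_coefE N)) PSeries_incr_1. Qed.

(** * The recursive coefficients [c] as those of a quotient of power series *)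

Section Quotient.

Variables (N : nat) (c : nat -> R).
Hypothesis c0 : c 0%N = 0.
Hypothesis cS : forall j : nat, (1 <= j)%N ->
  c j = 1 / a_coef N 0 *
        (b_coef N j -
         \big[Rplus/0]_(1 <= i < j.+1) (c (j - i)%N * a_coef N i)).

(** As a_0 = 1, the first term of the Cauchy product is c_j, and the recursion cancels the others.
    At j = 0 both sides vanish. *)
Lemma c_mul_a (j : nat) : PS_mult (a_coef N) c j = b_coef N j.
Proof.
rewrite /PS_mult -big_nat_sum_f_R0 big_ltn // a_coef0 Rmult_1_l.
case: j => [|j].
  by rewrite big_geq //= c0 /b_coef /= /Rdiv; ring.
have -> : (j.+1 - 0)%coq_nat = j.+1 by [].
under eq_bigr do rewrite Rmult_comm minusE.
by rewrite cS // a_coef0; field.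
Qed.

Lemma c_bound (j : nat) : Rabs (c j) <= 2 ^ j.
Proof.
elim/ltn_ind: j => -[|j] IHj; first by rewrite c0 Rabs_R0 /=; lra.
(* The bound telescopes: the term i = m+1 is at most 2^(j-m) = 2^(j+1-m) - 2^(j-m). The full sum is
   thus at most 2^(j+1) - 1, which leaves room for b_(j+1) <= 1. *)
have partial_sum m : (m <= j.+1)%N ->
    Rabs (\big[Rplus/0]_(1 <= i < m.+1) (c (j.+1 - i)%N * a_coef N i))
      <= 2 ^ j.+1 - 2 ^ (j.+1 - m).
  elim: m => [_|m IHm ltmj].
    by rewrite big_geq // Rabs_R0 subn0; lra.
  rewrite big_nat_recr //=; apply: Rle_trans (Rabs_triang _ _) _.
  have := IHm (ltnW ltmj); rewrite subSn // subSS.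
  have := IHj (j - m)%N (leq_subr m j); rewrite Rabs_mult.
  have [am_gt0 am_le1] := a_coef_bounds N m.+1.
  rewrite (Rabs_pos_eq (a_coef N m.+1)); last lra.
  by have := Rabs_pos (c (j - m)%N); rewrite /=; nra.
have := partial_sum j.+1 (leqnn _); rewrite subnn cS // a_coef0.
have -> (z : R) : 1 / 1 * z = z by field.
have := b_coef_bounds N j.+1 => bj sumj.
apply: Rle_trans (Rabs_triang _ _) _; rewrite Rabs_Ropp Rabs_pos_eq; last lra.
by move: sumj; rewrite /=; lra.
Qed.

Lemma CV_radius_c : Rbar_lt 0 (CV_radius c).
Proof.
(* By [c_bound] the terms of the series at 1/2 are bounded by 1, so the radius is at least 1/2. *)
apply: (Rbar_lt_le_trans _ (/ 2)); first by rewrite /=; lra.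
apply: (proj1 (CV_radius_bounded c)); exists 1 => n.
rewrite Rabs_mult -RPow_abs (Rabs_pos_eq (/ 2)); last lra.
apply: (Rle_trans _ (2 ^ n * (/ 2) ^ n)).
  by apply: Rmult_le_compat_r; [apply: pow_le; lra | apply: c_bound].
by rewrite -Rpow_mult_distr Rinv_r ?pow1; lra.
Qed.

Lemma PSeries_quotient (x : R) : 0 < x -> ex_pseries c x ->
  PSeries (b_coef N) x = PSeries (a_coef N) x * PSeries c x.
Proof.
move=> x_gt0 exc; apply: PSeries_mult_boundary => //.
- exact: c_mul_a.
- by rewrite CV_radius_a_coef.
- by rewrite CV_radius_b_coef.
- exact: CV_radius_c.
Qed.

End Quotient.

(** * The function [u], the norm and the feedback control *)

Lemma ex_series_a_coef (N : nat) (x : R) :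
  ex_series (fun n => a_coef N n * x ^ n).
Proof.
by apply/ex_pseries_R/CV_radius_inside; rewrite CV_radius_a_coef.
Qed.

Lemma uE (N : nat) (sigma r : R) :
  u N sigma r = PSeries (a_coef N) ((r ^ 2 / (2 * sigma ^ 2)) ^ 2).
Proof.
rewrite /u /PSeries [RHS]Series_incr_1; last exact: ex_series_a_coef.
rewrite a_coef0 pow_O Rmult_1_l; congr (_ + _); apply: Series_ext => k.
by rewrite -pow_mult.
Qed.

(** The constant term is 1 and the others are nonnegative, [u] being a series in a square. This
    justifies the logarithm in [v] and the division by [u]. *)
Lemma u_gt0 (N : nat) (sigma r : R) : 0 < u N sigma r.
Proof.
have x_ge0 := pow2_ge_0 (r ^ 2 / (2 * sigma ^ 2)).
rewrite uE; set x := (_ ^ 2) in x_ge0 *.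
rewrite /PSeries Series_incr_1; last exact: ex_series_a_coef.
rewrite a_coef0 pow_O Rmult_1_l.
apply: Rplus_lt_le_0_compat; first lra.
(* Writing 0 as 0 times the tail allows a termwise comparison. *)
rewrite -(Rmult_0_l (Series (fun k => a_coef N k.+1 * x ^ k.+1))) -Series_scal_l.
apply: Series_le; last exact: (proj1 (ex_series_incr_1 _) (ex_series_a_coef N x)).
move=> k; rewrite Rmult_0_l; split; first exact: Rle_refl.
by apply: Rmult_le_pos; [have := a_coef_bounds N k.+1; lra | apply: pow_le].
Qed.

(** Chain rule: the factor r^3 / sigma^4 is the derivative of r^4 / (4 sigma^4). *)
Lemma is_derive_u (N : nat) (sigma r : R) : sigma <> 0 ->
  is_derive (u N sigma) r
    (r ^ 3 / sigma ^ 4 *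
     PSeries (PS_derive (a_coef N)) ((r ^ 2 / (2 * sigma ^ 2)) ^ 2)).
Proof.
move=> sigma_neq0.
apply: (is_derive_ext (fun t =>
  PSeries (a_coef N) ((t ^ 2 / (2 * sigma ^ 2)) ^ 2))) => [t|].
  by rewrite uE.
apply: is_derive_comp.
  by apply: is_derive_PSeries; rewrite CV_radius_a_coef.
by auto_derive; [| field]; rewrite //=; lra.
Qed.

Lemma is_derive_enorm (N : nat) (y : 'I_N -> R) (i : 'I_N) : enorm y <> 0 ->
  is_derive (fun t => enorm (fun k => if k == i then t else y k)) (y i)
    (y i / enorm y).
Proof.
move=> r_neq0.
pose S := \big[Rplus/0]_(k < N | k != i) (y k ^ 2).
have enormE t : enorm (fun k => if k == i then t else y k) = sqrt (t ^ 2 + S).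
  rewrite /enorm (bigD1 i) //= eqxx /S; congr (sqrt (_ + _)).
  by apply: eq_bigr => k /negPf ->.
have rE : enorm y = sqrt (y i ^ 2 + S) by rewrite /enorm (bigD1 i).
(* [sqrt] is 0 on nonpositive reals, so a nonzero norm forces a positive radicand. *)
have rad_gt0 : 0 < y i ^ 2 + S.
  by apply: Rnot_le_lt => /sqrt_neg_0; rewrite -rE.
apply: (is_derive_ext (fun t => sqrt (t ^ 2 + S))) => [t|].
  by rewrite enormE.
auto_derive; first by move: rad_gt0; rewrite /=; lra.
move: r_neq0; rewrite rE /= Rmult_1_r => r_neq0; field.
exact: r_neq0.
Qed.

Lemma pbarE (N : nat) (sigma : R) (i : 'I_N) (y : 'I_N -> R) :
  sigma <> 0 -> enorm y <> 0 ->
  pbar sigma i y = sigma ^ 2 * Derive (u N sigma) (enorm y) * y i /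
                   (enorm y * u N sigma (enorm y)).
Proof.
move=> sigma_neq0 r_neq0.
(* The updated point agrees with [y] only pointwise, so the norms are compared instead of the
   functions. *)
have enorm_yi : enorm (fun k => if k == i then y i else y k) = enorm y.
  by rewrite /enorm; congr sqrt; apply: eq_bigr => k _; case: eqP => [->|].
have ur_gt0 := u_gt0 N sigma (enorm y).
have du := is_derive_u N sigma (enorm y) sigma_neq0.
rewrite (is_derive_unique _ _ _ du) /pbar /partial.
set d := _ * PSeries _ _ in du *.
have -> : Derive (fun t => v sigma (fun k => if k == i then t else y k)) (y i) =
    2 * sigma ^ 2 * (y i / enorm y * (d * / u N sigma (enorm y))).
  apply: is_derive_unique; rewrite /v; apply: is_derive_scal.
  apply: (is_derive_comp (fun s => ln (u N sigma s))); last exact: is_derive_enorm.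
  rewrite enorm_yi; apply: (is_derive_comp ln) => //.
  exact: is_derive_ln.
by field; lra.
Qed.

Theorem theorem3p3 (N : nat) (sigma : R) (c : nat -> R)
  (hN : (1 <= N)%N) (hsigma : sigma <> 0)
  (hc0 : c 0%N = 0)
  (hc : forall j : nat, (1 <= j)%N ->
     c j = 1 / a_coef N 0 *
           (b_coef N j -
            \big[Rplus/0]_(1 <= i < j.+1) (c (j - i)%N * a_coef N i))) :
  Rbar_lt 0 (CV_radius c) /\
  forall y : 'I_N -> R,
    let r := enorm y in
    r <> 0 ->
    (forall i : 'I_N, y i <> 0 ->
       pbar sigma i y / y i
         = sigma ^ 2 * (Derive (u N sigma) r / (r * u N sigma r))) /\
    (ex_series (fun j : nat => c j * (r ^ 4 / (4 * sigma ^ 4)) ^ j) ->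
       sigma ^ 2 * (Derive (u N sigma) r / (r * u N sigma r))
         = 4 * sigma ^ 2 / r ^ 2 *
           Series (fun j : nat => c j * (r ^ 4 / (4 * sigma ^ 4)) ^ j)).
Proof.
split; first exact: CV_radius_c hc0 hc.
move=> y r r_neq0; have ur_gt0 := u_gt0 N sigma r; split.
  move=> i yi_neq0; rewrite pbarE // -/r; field; repeat split => //; lra.
set x := r ^ 4 / (4 * sigma ^ 4) => /ex_pseries_R exc.
have xE : (r ^ 2 / (2 * sigma ^ 2)) ^ 2 = x by rewrite /x; field.
have x_gt0 : 0 < x.
  have ne0 : r ^ 2 / (2 * sigma ^ 2) <> 0.
    apply: Rmult_integral_contrapositive_currified; first exact: pow_nonzero.
    by apply/Rinv_neq_0_compat; have := pow_nonzero _ 2 hsigma; lra.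
  by rewrite -xE; apply: pow2_gt_0.
(* With C the sum of the series of [c], this reads x A'(x) = A(x) C(x). Since A(x) = u(r) > 0, it
   can be solved for C(x), and r u'(r) = 4 x A'(x) gives the claim. *)
have := PSeries_quotient N c hc0 hc x x_gt0 exc.
rewrite PSeries_b_coef (is_derive_unique _ _ _ (is_derive_u N sigma r hsigma)).
move: ur_gt0; rewrite uE xE -/(PSeries c x) => ua_gt0 quoE.
have -> : PSeries c x =
    x * PSeries (PS_derive (a_coef N)) x / PSeries (a_coef N) x.
  by rewrite quoE; field; lra.
set D := PSeries (PS_derive _) x; set A := PSeries _ x in ua_gt0 *.
by rewrite /x; field; repeat split => //; lra.
Qed.
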